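(* Let $m\ge 2$ be an integer and let $H$ be a finite, simple, connected graph of order at least $2$. The Cartesian product $K_m \,\square\, H$ is well-dominated if and only if either $m \neq 3$ and $H$ is isomorphic to $K_m$, or $m=3$ and $H$ is isomorphic to $K_3$ or to the path $P_3$ on three vertices.
   Context: A set $D$ of vertices of a graph is dominating if every vertex is in $D$ or adjacent to a vertex of $D$. A graph is well-dominated if every minimal (with respect to inclusion) dominating set is a minimum dominating set. The Cartesian product $G\,\square\, H$ has vertex set $V(G)\times V(H)$, with $(g_1,h_1)$ adjacent to $(g_2,h_2)$ iff either ($g_1=g_2$ and $h_1h_2\in E(H)$) or ($h_1=h_2$ and $g_1g_2\in E(G)$). *)

(* Defs.v *)
From mathcomp Require Import all_boot.
Set Implicit Arguments. Unset Strict Implicit. Unset Printing Implicit Defensive.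

Definition simple_graph (V : finType) (e : rel V) : Prop :=
  symmetric e /\ irreflexive e.

Definition connected_graph (V : finType) (e : rel V) : Prop :=
  forall x y : V, connect e x y.

Definition dominating (V : finType) (e : rel V) (D : {set V}) : Prop :=
  forall v : V, v \in D \/ exists2 u, u \in D & e u v.

Definition minimal_dominating (V : finType) (e : rel V) (D : {set V}) : Prop :=
  dominating e D /\ forall D' : {set V}, D' \proper D -> ~ dominating e D'.

Definition minimum_dominating (V : finType) (e : rel V) (D : {set V}) : Prop :=
  dominating e D /\ forall D' : {set V}, dominating e D' -> #|D| <= #|D'|.

Definition well_dominated (V : finType) (e : rel V) : Prop :=
  forall D : {set V}, minimal_dominating e D -> minimum_dominating e D.

Definition cartesian_product (VG VH : finType) (eG : rel VG) (eH : rel VH)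
  : rel (VG * VH) :=
  fun x y => ((x.1 == y.1) && eH x.2 y.2) || ((x.2 == y.2) && eG x.1 y.1).

Definition complete_graph (m : nat) : rel 'I_m := fun i j => i != j.

Definition path3 : rel 'I_3 := fun i j => (i.+1 == j :> nat) || (j.+1 == i :> nat).

Definition graph_iso (V1 V2 : finType) (e1 : rel V1) (e2 : rel V2) : Prop :=
  exists f : V1 -> V2, bijective f /\ forall x y, e2 (f x) (f y) = e1 x y.
Arguments complete_graph m : clear implicits.

(* Main.v *)
Require Import Defs.
From mathcomp Require Import all_boot.
From mathcomp Require Import zify.
Set Implicit Arguments. Unset Strict Implicit. Unset Printing Implicit Defensive.

(** The row [{0} x V(H)] is a minimal dominating set, so well-dominatedness
    forces [#|E| <= #|V(H)| <= #|S|] whenever [S] is dominating and every element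
    of [E], a subset of [S], has a private neighbour with respect to [S].
    Applied to sets made of a few (possibly punctured) [K_m]-layers together
    with a part of row [0], this shows that all degrees in [H] are [m-1] or
    [m-2], and that adjacent vertices with incomparable closed neighbourhoods
    have degree [m-1] and no common neighbour.  If all degrees are [m-1], then
    [H = K_m].  A vertex [v] of degree [m-2] has a neighbour [h] with
    [N[h] = N[v] + w]; then [w] has degree [m-2] too, and [H] is the path
    [v h w] with [m = 3].

    Conversely, in the listed products every dominating set contains a
    dominating set which is a transversal of the [K_m]-layers or of the
    [H]-layers, hence has [m] elements. *)

(** * Well-dominated and connected graphs in general *)

Section Domination.

Variables (V : finType) (e : rel V).
Implicit Types D S E : {set V}.

Lemma dominatingS D S : D \subset S -> dominating e D -> dominating e S.
Proof.
move=> /subsetP sDS dD v; case: (dD v) => [/sDS|[u /sDS uS uv]]; first by left.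
by right; exists u.
Qed.

Lemma minimal_dominating_exists S : dominating e S ->
  exists2 D : {set V}, D \subset S & minimal_dominating e D.
Proof.
pose domb := fun D : {set V} => [forall v, (v \in D) || [exists u in D, e u v]].
have dombP D : reflect (dominating e D) (domb D).
  apply: (iffP forallP) => dD v; have := dD v.
    by case/orP => [|/exists_inP[u uD uv]]; [left|right; exists u].
  by case=> [->//|[u uD uv]]; apply/orP; right; apply/exists_inP; exists u.
move=> /dombP dS; have [D /minsetP[dD minD] sDS] := minset_exists dS.
exists D; first by [].
split; first exact/dombP.
move=> D' /properP[sD'D [x xD xD']] /dombP dD'.
by move: xD'; rewrite (minD _ dD' sD'D) xD.
Qed.

(** A minimal dominating set inside [S] cannot omit any point of [E], and well-dominatedness makes
    it no larger than [D0]. *)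
Lemma well_dominated_card D0 S E :
    well_dominated e -> minimal_dominating e D0 -> dominating e S ->
    E \subset S -> {in E, forall x, ~ dominating e (S :\ x)} ->
  #|E| <= #|D0|.
Proof.
move=> wd mD0 dS sES essE.
have [D sDS mD] := minimal_dominating_exists dS; have [_ minD] := wd _ mD.
apply: leq_trans (minD D0 mD0.1).
apply/subset_leq_card/subsetP => x xE; apply: contraT => xD.
case: (essE x xE); apply: dominatingS mD.1.
by rewrite subsetD1 sDS xD.
Qed.

(** A minimal [D] equals its own subset of size [k], while every dominating set contains one of size
    [k] and so has at least [k] elements. *)
Lemma well_dominated_const k :
    (forall D, dominating e D ->
       exists D', [/\ D' \subset D, dominating e D' & #|D'| = k]) ->
  well_dominated e.
Proof.
move=> sub D [dD minD]; have [D1 [sD1 dD1 cD1]] := sub D dD.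
have eD : D1 = D.
  by apply/eqP; rewrite eqEproper sD1; apply/negP => /minD; apply.
split=> // D2 /sub[D3 [sD3 _ cD3]].
by rewrite -eD cD1 -cD3 subset_leq_card.
Qed.

Lemma connected_closed_setT (A : {set V}) x :
    connected_graph e -> x \in A ->
    (forall y z, y \in A -> e y z -> z \in A) ->
  A = setT.
Proof.
move=> con xA clA; apply/setP => y; rewrite inE.
have /connectP[p] := con x y.
elim: p x xA => [|z p IHp] x xA /= => [_ -> //|/andP[xz]].
exact/IHp/(clA x).
Qed.

Lemma connected_neighbour x :
  connected_graph e -> 2 <= #|V| -> exists y, e x y.
Proof.
move=> con V2; apply/existsP; apply: contraT => /existsPn noy.
have sT : [set x] = setT.
  apply: (connected_closed_setT con (set11 x)) => y z /set1P->.
  by rewrite (negPf (noy z)).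
by move: V2; rewrite -cardsT -sT cards1.
Qed.

End Domination.

(** * Domination in the product of a complete graph with H *)

Section Product.

Variables (k : nat) (V : finType) (e : rel V).
Hypotheses (sym_e : symmetric e) (irr_e : irreflexive e).

Local Notation m := k.+2.
Local Notation prod := (cartesian_product (complete_graph m) e).

(** Closed adjacency of the product: in a $K_m$-layer any two points are equal or adjacent. Being
    reflexive, it removes the case split in [dominating]. *)
Definition prod_adj (x y : 'I_m * V) := (x.2 == y.2) || (x.1 == y.1) && e x.2 y.2.

Lemma dominating_prodP (D : {set 'I_m * V}) :
  dominating prod D <-> forall y, exists2 x, x \in D & prod_adj x y.
Proof.
split=> dD y.
  case: (dD y) => [yD|[x xD]]; first by exists y; rewrite ?/prod_adj ?eqxx.
  by case/orP => [xy|/andP[xy _]]; exists x; rewrite // /prod_adj xy ?orbT.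
case: (dD y) => x xD xy; have [<-|neq] := eqVneq x y; first by left.
right; exists x => //; rewrite /cartesian_product /complete_graph.
case/orP: xy => [/eqP xy|->//]; rewrite xy eqxx orbC /=.
by apply/orP; left; apply: contra_neq neq => xy1; apply: injective_projections.
Qed.

Lemma private_essential (S : {set 'I_m * V}) x y :
    (forall z, z \in S -> prod_adj z y -> z = x) ->
  ~ dominating prod (S :\ x).
Proof.
move=> priv /dominating_prodP /(_ y)[z /setD1P[zx zS] zy].
by rewrite (priv z zS zy) eqxx in zx.
Qed.

Definition row0 : {set 'I_m * V} := setX [set ord0] setT.

Lemma card_row0 : #|row0| = #|V|.
Proof. by rewrite cardsX cards1 cardsT mul1n. Qed.

Lemma row0_minimal : minimal_dominating prod row0.
Proof.
have dom0 : dominating prod row0.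
  apply/dominating_prodP => y; exists (ord0, y.2); first by rewrite !inE.
  by rewrite /prod_adj eqxx.
split=> // D /properP[sD [x x0 xD]] dD.
(* As $m \ge 2$, [ord_max] differs from [ord0], so the point of row [ord_max] above [x.2] sees row 0
   only at [x]. *)
apply: (@private_essential row0 x (ord_max, x.2)).
  case=> i z; rewrite !inE andbT => /eqP /= -> /orP[/=/eqP->|/andP[]//].
  by case: x x0 {xD} => j u; rewrite !inE andbT => /eqP /= ->.
by apply: dominatingS dD; rewrite subsetD1 sD.
Qed.

(** With [R = setT] the $K_m$-layers over [A] are whole, with [R = [set~ ord0]] they are punctured
    in row 0. Varying [R] alone yields both a dominating set and its subset of essential points. *)
Definition layers (R : {set 'I_m}) (A B : {set V}) : {set 'I_m * V} :=
  setX R A :|: setX [set ord0] B.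

Lemma card_layers R (A B : {set V}) : [disjoint A & B] ->
  #|layers R A B| = #|R| * #|A| + #|B|.
Proof.
move=> dAB; rewrite cardsU !cardsX cards1 mul1n.
rewrite (_ : _ :&: _ = set0) ?cards0 ?subn0 //.
apply/setP => -[i x]; rewrite !inE /=.
case xA: (x \in A); last by rewrite andbF.
by rewrite (disjointFr dAB xA) !andbF.
Qed.

Lemma layersS (R R' : {set 'I_m}) A B :
  R \subset R' -> layers R A B \subset layers R' A B.
Proof.
by move=> sR; apply: setSU; apply/subsetP => x; rewrite !inE;
  case/andP => /(subsetP sR)-> ->.
Qed.

Lemma cardsC0 : #|[set~ (ord0 : 'I_m)]| = k.+1.
Proof. by rewrite cardsC1 card_ord. Qed.

Lemma layersT_dominating (A B : {set V}) :
    (forall y, y \notin A -> y \notin B -> exists2 a, a \in A & e a y) ->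
  dominating prod (layers setT A B).
Proof.
move=> dom; apply/dominating_prodP => -[i y].
have [yA|yA] := boolP (y \in A).
  by exists (i, y); rewrite ?inE ?yA // /prod_adj eqxx.
have [yB|yB] := boolP (y \in B).
  by exists (ord0, y); rewrite ?inE ?yB ?orbT // /prod_adj eqxx.
have [a aA ay] := dom y yA yB.
by exists (i, a); rewrite ?inE ?aA // /prod_adj eqxx ay orbT.
Qed.

(** The removed points [(ord0, a)] stay dominated inside their own layers. The other points of row 0
    can no longer be reached from [A], so [B] must take over. *)
Lemma layersC0_dominating (A B : {set V}) :
    (forall y, y \notin A -> y \notin B -> exists2 a, a \in A & e a y) ->
    (forall y, y \notin A -> y \notin B -> exists2 b, b \in B & e b y) ->
  dominating prod (layers [set~ ord0] A B).
Proof.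
move=> domA domB; apply/dominating_prodP => -[i y].
have [yA|yA] := boolP (y \in A).
  by exists (ord_max, y); rewrite ?inE ?yA // /prod_adj eqxx.
have [yB|yB] := boolP (y \in B).
  by exists (ord0, y); rewrite ?inE ?yB ?orbT // /prod_adj eqxx.
have [->|i0] := eqVneq i ord0.
  have [b bB yb] := domB y yA yB.
  by exists (ord0, b); rewrite ?inE ?bB ?orbT // /prod_adj eqxx yb orbT.
have [a aA ay] := domA y yA yB.
by exists (i, a); rewrite ?inE ?aA ?i0 // /prod_adj eqxx ay orbT.
Qed.

(** The private neighbour is [(ord_max, y)]: its row meets the set only over [A], which has no
    neighbour of [y]. *)
Lemma layers_row_essential R (A B : {set V}) y :
    y \notin A -> {in A, forall a, ~~ e a y} ->
  ~ dominating prod (layers R A B :\ (ord0, y)).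
Proof.
move=> yA nA; apply: (@private_essential _ _ (ord_max, y)) => -[i x].
rewrite !inE /prod_adj /=.
case/orP=> /andP[iR xA] /orP[/eqP xy|/andP[/eqP ix xy]].
- by rewrite -xy xA in yA.
- by have := nA x xA; rewrite xy.
- by rewrite (eqP iR) xy.
- by rewrite ix in iR.
Qed.

(** The private neighbour is [(i, p)]; the points over [B] threaten it only when [i] is row 0. *)
Lemma layers_col_essential R (A B : {set V}) i a p :
    p \notin A -> p \notin B -> {in A, forall x, e x p -> x = a} ->
    i != ord0 \/ {in B, forall b, ~~ e b p} ->
  ~ dominating prod (layers R A B :\ (i, a)).
Proof.
move=> pA pB priv hi; apply: (@private_essential _ _ (i, p)) => -[j x].
rewrite !inE /prod_adj /=.
case/orP=> /andP[jR xA] /orP[/eqP xp|/andP[/eqP ji xp]].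
- by rewrite -xp xA in pA.
- by rewrite ji (priv x xA xp).
- by rewrite -xp xA in pB.
case: hi => [|/(_ x xA)]; first by rewrite -ji jR.
by rewrite xp.
Qed.

(** Puncturing leaves only [B] in row 0, so [(ord0, y)] is its own private neighbour. *)
Lemma layers_isolated_essential (A B : {set V}) y :
    y \notin A -> {in B, forall b, ~~ e b y} ->
  ~ dominating prod (layers [set~ ord0] A B :\ (ord0, y)).
Proof.
move=> yA nB; apply: (@private_essential _ _ (ord0, y)) => -[i x].
rewrite !inE /prod_adj /=.
case/orP=> /andP[iR xA] /orP[/eqP xy|/andP[/eqP ix xy]].
- by rewrite -xy xA in yA.
- by rewrite ix in iR.
- by rewrite (eqP iR) xy.
- by have := nB x xA; rewrite xy.
Qed.

(** Degrees are measured by closed neighbourhoods: degrees $m-1$ and $m-2$ become cardinals [k.+2]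
    and [k.+1]. *)
Definition clN v : {set V} := [set u | (u == v) || e v u].

Let inU := (in_setU, in_setC, in_set1, in_set2).

Lemma clN_sym x y : (x \in clN y) = (y \in clN x).
Proof. by rewrite !inE eq_sym sym_e. Qed.

Lemma clN_refl x : x \in clN x. Proof. by rewrite inE eqxx. Qed.

Lemma edge_clN x y : e x y = (x != y) && (y \in clN x).
Proof. by rewrite inE eq_sym; case: eqVneq => [->|_] //=; rewrite irr_e. Qed.

Lemma edge_in_clN x y : e x y -> y \in clN x.
Proof. by rewrite inE => ->; rewrite orbT. Qed.

(** * Necessity: closed neighbourhoods of H when the product is well-dominated *)

Section Necessity.

Hypotheses (con_e : connected_graph e) (V2 : 2 <= #|V|).
Hypothesis wd : well_dominated prod.

Lemma layersT_card (A B : {set V}) : [disjoint A & B] ->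
    (forall y, y \notin A -> y \notin B -> exists2 a, a \in A & e a y) ->
  #|V| <= m * #|A| + #|B|.
Proof.
move=> dAB /layersT_dominating dom.
have := (wd row0_minimal).2 _ dom.
by rewrite card_row0 card_layers // cardsT card_ord.
Qed.

Lemma layers_essential_card (R : {set 'I_m}) (A B : {set V}) : [disjoint A & B] ->
    [set~ ord0] \subset R -> dominating prod (layers setT A B) ->
    {in layers R A B, forall x, ~ dominating prod (layers setT A B :\ x)} ->
  #|R| * #|A| + #|B| <= #|V|.
Proof.
move=> dAB sR dom ess.
have := well_dominated_card wd row0_minimal dom (layersS _ _ (subsetT R)) ess.
by rewrite card_row0 card_layers.
Qed.

Lemma disjoint_setC (A C : {set V}) :
  {in A, forall a, a \in C} -> [disjoint A & ~: C].
Proof. by move=> AC; rewrite disjoints_subset setCK; apply/subsetP. Qed.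

Lemma column_dominating v y :
  y \notin [set v] -> y \notin ~: clN v -> exists2 a, a \in [set v] & e a y.
Proof.
rewrite !inE negbK => /negPf-> /= vy.
by exists v; rewrite ?inE.
Qed.

Lemma column_disjoint v : [disjoint [set v] & ~: clN v].
Proof. by apply: disjoint_setC => a /set1P->; apply: clN_refl. Qed.

(** The whole layer over [v] and row 0 outside $N[v]$ form a dominating set of size $m + |V| -
    |N[v]|$, which is at least $|V|$. *)
Lemma card_clN_le v : #|clN v| <= m.
Proof.
have := layersT_card (column_disjoint v) (@column_dominating v).
by rewrite cards1 muln1 -(cardsC (clN v)) leq_add2r.
Qed.

(** In the same dominating set all points except perhaps [(ord0, v)] are essential: a neighbour [p]
    of [v] makes [(i, p)] private to [(i, v)] for [i] nonzero. *)
Lemma card_clN_ge v : k.+1 <= #|clN v|.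
Proof.
have [p vp] := connected_neighbour v con_e V2.
have pv : p != v by apply: contraTneq vp => ->; rewrite irr_e.
have := @layers_essential_card [set~ ord0] [set v] (~: clN v).
rewrite cardsC0 cards1 muln1 => /(_ (column_disjoint v) (subxx _)).
move=> /(_ (layersT_dominating (@column_dominating v))).
have := cardsC (clN v) => H1 H2.
suff: k.+1 + #|~: clN v| <= #|V| by lia.
apply: {H1} H2 => -[i x]; rewrite 2!inE => /orP[]; rewrite !inE /=.
  case/andP => i0 /eqP->; apply: (@layers_col_essential _ _ _ _ _ p).
  - by rewrite inE.
  - by rewrite !inE vp orbT.
  - by move=> y /set1P.
  - by left.
rewrite negb_or => /andP[/eqP-> /andP[xv vx]].
by apply: layers_row_essential; rewrite ?inE // => a /set1P->.
Qed.

(** Otherwise [(ord0, h)] would be private to [(ord0, v)], and all $m + |V| - (m-1)$ points of the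
    set would be essential. *)
Lemma clN_not_sub v h : #|clN v| = k.+1 -> e v h -> ~~ (clN h \subset clN v).
Proof.
move=> cv vh; apply/negP => /subsetP sub.
have hv : h != v by apply: contraTneq vh => ->; rewrite irr_e.
have := @layers_essential_card setT [set v] (~: clN v).
rewrite cardsT card_ord cards1 muln1 => /(_ (column_disjoint v) (subsetT _)).
move=> /(_ (layersT_dominating (@column_dominating v))).
have := cardsC (clN v) => H1 H2.
suff: m + #|~: clN v| <= #|V| by lia.
apply: {H1} H2 => -[i x]; rewrite 2!inE => /orP[]; rewrite !inE /=.
  move/eqP->; apply: (@layers_col_essential _ _ _ _ _ h).
  - by rewrite inE.
  - by rewrite !inE vh orbT.
  - by move=> y /set1P.
  - right=> b; rewrite inE => bv; apply: contra bv => bh.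
    by apply: sub; rewrite -clN_sym edge_in_clN.
rewrite negb_or => /andP[/eqP-> /andP[xv vx]].
by apply: layers_row_essential; rewrite ?inE // => a /set1P->.
Qed.

(** If every neighbour of [v] had a neighbour outside $N[v]$, the layer over [v] could be punctured,
    leaving a dominating set of size $|V| - 1$. *)
Lemma clN_sub_exists v : #|clN v| = m -> exists2 h, e v h & clN h \subset clN v.
Proof.
move=> cv; apply/exists_inP; apply: contraT.
rewrite negb_exists_in => /forall_inP nsub.
have dom : dominating prod (layers [set~ ord0] [set v] (~: clN v)).
  apply: layersC0_dominating => [|y]; first exact: column_dominating.
  rewrite in_set1 in_setC negbK => yv vy; have := nsub y.
  rewrite edge_clN vy eq_sym yv => /(_ isT) /subsetPn[b yb vb].
  exists b; first by rewrite in_setC.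
  by rewrite sym_e edge_clN yb andbT; apply: contraNneq vb => <-.
have := (wd row0_minimal).2 _ dom.
rewrite card_row0 card_layers ?column_disjoint // cardsC0 cards1 muln1.
by have := cardsC (clN v); lia.
Qed.

Lemma column2_dominating a b y : y \notin [set a; b] ->
  y \notin ~: (clN a :|: clN b) -> exists2 c, c \in [set a; b] & e c y.
Proof.
rewrite !inE negbK negb_or => /andP[/negPf-> /negPf->] /= /orP[] cy.
  by exists a; rewrite // !inE eqxx.
by exists b; rewrite // !inE eqxx orbT.
Qed.

Lemma column2_disjoint a b : [disjoint [set a; b] & ~: (clN a :|: clN b)].
Proof.
by apply: disjoint_setC => c /set2P[]->; rewrite inE clN_refl ?orbT.
Qed.

Lemma column2_row_essential a b x :
    x \in ~: (clN a :|: clN b) ->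
  ~ dominating prod
      (layers setT [set a; b] (~: (clN a :|: clN b)) :\ (ord0, x)).
Proof.
rewrite !inE !negb_or => /andP[/andP[xa ax] /andP[xb bx]].
apply: layers_row_essential; first by rewrite !inE negb_or xa.
by move=> c /set2P[]->.
Qed.

(** [(i, p)] is private to [(i, a)]: it is not seen from the layer over [b], and in row 0 the
    inclusion keeps it away from the points outside both neighbourhoods. *)
Lemma column2_col_essential a b i p :
    p \in clN a -> p \notin clN b -> e a b ->
    i != ord0 \/ clN p \subset clN a ->
  ~ dominating prod
      (layers setT [set a; b] (~: (clN a :|: clN b)) :\ (i, a)).
Proof.
move=> pa pb ab hi.
have pna : p != a.
  by apply: contraNneq pb => ->; rewrite clN_sym edge_in_clN.
apply: (@layers_col_essential _ _ _ _ _ p).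
- rewrite !inE negb_or pna; apply: contraNneq pb => ->; exact: clN_refl.
- by rewrite !inE in pa *; rewrite pa.
- move=> x /set2P[] // -> bp.
  by rewrite edge_in_clN in pb.
case: hi => [|/subsetP sub]; [by left|right=> y; rewrite !inE negb_or].
move=> /andP[ya _]; apply: contra ya => yp.
have: y \in clN a by apply: sub; rewrite clN_sym edge_in_clN.
by rewrite inE.
Qed.

Lemma card_clN_meet a b : e a b ->
    #|clN a :|: clN b| + #|clN a :&: clN b| <= m + m /\
    [set a; b] \subset clN a :&: clN b.
Proof.
move=> ab; split.
  by rewrite cardsUI leq_add ?card_clN_le.
apply/subsetP => c /set2P[]->; rewrite in_setI clN_refl ?andbT /=.
  by rewrite clN_sym edge_in_clN.
exact: edge_in_clN.
Qed.

Lemma edge_neq a b : e a b -> a != b.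
Proof. by rewrite edge_clN => /andP[]. Qed.

(** The $2(m-1)$ points off row 0 over [a] and [b] are essential, as is row 0 outside $N[a] \cup
    N[b]$. Since both neighbourhoods have at most $m$ elements and share [a] and [b], equality must
    hold throughout. *)
Lemma incomparable_card_clN a b : e a b ->
    ~~ (clN a \subset clN b) -> ~~ (clN b \subset clN a) ->
  k.+1 + k.+1 <= #|clN a :|: clN b|.
Proof.
move=> ab /subsetPn[p pa pb] /subsetPn[q qb qa].
have := @layers_essential_card [set~ ord0] [set a; b] (~: (clN a :|: clN b)).
rewrite cardsC0 cards2 edge_neq //.
move=> /(_ (column2_disjoint a b) (subxx _)).
move=> /(_ (layersT_dominating (@column2_dominating a b))).
have := cardsC (clN a :|: clN b) => H1 H2.
suff: k.+1 * 2 + #|~: (clN a :|: clN b)| <= #|V| by lia.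
apply: {H1} H2 => -[i x] /setUP[] /setXP[/=].
  rewrite in_setC1 => i0 /set2P[]->.
    by apply: (@column2_col_essential _ _ _ p) => //; left.
  rewrite setUC [clN a :|: _]setUC.
  by apply: (@column2_col_essential _ _ _ q); rewrite 1?sym_e //; left.
by move=> /set1P->; apply: column2_row_essential.
Qed.

(** Here all $2m$ points over [a] and [b] are essential, forcing a union of size $2m$, although the
    two neighbourhoods share [a] and [b]. *)
Lemma no_pendant_pair a b p q : e a b ->
    p \in clN a -> clN p \subset clN a -> p \notin clN b ->
    q \in clN b -> clN q \subset clN b -> q \notin clN a -> False.
Proof.
move=> ab pa spa pb qb sqb qa.
have := @layers_essential_card setT [set a; b] (~: (clN a :|: clN b)).
rewrite cardsT card_ord cards2 edge_neq //.
move=> /(_ (column2_disjoint a b) (subsetT _)).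
move=> /(_ (layersT_dominating (@column2_dominating a b))).
have [H1 /subset_leq_card] := card_clN_meet ab; rewrite cards2 edge_neq //.
have := cardsC (clN a :|: clN b) => H2 H3 H4.
suff: m * 2 + #|~: (clN a :|: clN b)| <= #|V| by lia.
apply: {H1 H2 H3} H4 => -[i x] /setUP[] /setXP[/=].
  move=> _ /set2P[]->.
    by apply: (@column2_col_essential _ _ _ p) => //; right.
  rewrite setUC [clN a :|: _]setUC.
  by apply: (@column2_col_essential _ _ _ q); rewrite 1?sym_e //; right.
by move=> /set1P->; apply: column2_row_essential.
Qed.

(** Puncture the layer over [h] and add [v] and [w] to row 0 outside $N[h]$. This dominating set has
    $(m-1) + (|V|-m) + 2 = |V|+1$ points, and [u] helps to make all of them essential. *)
Lemma no_third_neighbour h v w u : #|clN h| = m ->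
    e h v -> e h w -> v != w -> ~~ e v w ->
    clN v \subset clN h -> clN w \subset clN h -> clN h \subset clN v :|: [set w] ->
    e h u -> u != v -> u != w -> False.
Proof.
move=> ch hv hw vw nvw /subsetP svh /subsetP swh /subsetP shv hu uv uw.
pose B := ~: clN h :|: [set v; w].
have hB : h \notin B.
  by rewrite !inU clN_refl /= negb_or !edge_neq.
have dB : [disjoint [set h] & B] by rewrite disjoints1.
have dom : dominating prod (layers [set~ ord0] [set h] B).
  apply: layersC0_dominating => y yh; rewrite !inU !negb_or negbK.
    move=> /andP[hy _]; exists h; first exact: set11.
    by rewrite edge_clN hy andbT eq_sym -in_set1.
  case/and3P=> hy yv yw; exists v; first by rewrite !inU eqxx orbT.
  by have := shv y hy; rewrite !inE (negPf yv) (negPf yw) orbF.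
have cB : #|B| = #|V| - m + 2.
  rewrite cardsU cards2 vw -ch -(cardsC (clN h)) addKn.
  rewrite (_ : _ :&: _ = set0) ?cards0 ?subn0 //.
  apply/setP => y; rewrite in_setI !inU in_set0; apply/negbTE/negP => /andP[yh] /orP[]/eqP yE;
  by rewrite yE edge_in_clN in yh.
have nB b x : b \in B -> {subset clN x <= clN h} ->
    e b x -> (b == v) || (b == w).
  rewrite !inU => /orP[bh|//] sx bx; case/negP: bh.
  by apply: sx; rewrite clN_sym edge_in_clN.
have := well_dominated_card wd row0_minimal dom (subxx _).
rewrite card_row0 card_layers // cardsC0 cards1 cB.
suff ess : {in layers [set~ ord0] [set h] B,
    forall x, ~ dominating prod (layers [set~ ord0] [set h] B :\ x)}.
  by move=> /(_ ess) H; have := max_card (mem (clN h)); lia.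
case=> i x /setUP[] /setXP[/=].
  rewrite in_setC1 => i0 /set1P->; apply: (@layers_col_essential _ _ _ _ _ u).
  - by rewrite inE eq_sym edge_neq.
  - rewrite !inU (negPf uv) (negPf uw) !orbF negbK.
    exact: edge_in_clN.
  - by move=> y /set1P.
  - by left.
move=> /set1P->; case/setUP => [|/set2P[]->].
- rewrite !inE negb_or => /andP[xh hx].
  by apply: layers_row_essential; rewrite ?inE // => a /set1P->.
- apply: layers_isolated_essential; first by rewrite inE eq_sym edge_neq.
  move=> b bB; apply/negP => bv.
  have := nB b v bB svh bv.
  case/orP => /eqP bE; first by rewrite bE irr_e in bv.
  by rewrite bE sym_e (negPf nvw) in bv.
- apply: layers_isolated_essential; first by rewrite inE eq_sym edge_neq.
  move=> b bB; apply/negP => bw.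
  have := nB b w bB swh bw.
  case/orP => /eqP bE; first by rewrite bE (negPf nvw) in bw.
  by rewrite bE irr_e in bw.
Qed.

Lemma clN_sub_of_small v h : #|clN v| = k.+1 -> e v h ->
  clN v \subset clN h /\ #|clN h| = m.
Proof.
move=> cv vh; have nhv := clN_not_sub cv vh.
have svh : clN v \subset clN h.
  apply: contraT => nvh; have := incomparable_card_clN vh nvh nhv.
  have [_ /subset_leq_card] := card_clN_meet vh; rewrite cards2 edge_neq //.
  have := cardsUI (clN v) (clN h); rewrite cv; have := card_clN_le h; lia.
split=> //; apply/eqP; rewrite eqn_leq card_clN_le.
have: clN v \proper clN h by rewrite properE svh.
by move/proper_card; rewrite cv.
Qed.

Lemma small_degree_path v : #|clN v| = k.+1 ->
  k = 1 /\ exists h w,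
    [/\ [set: V] = [set v; h; w], v != w, e v h, e h w & ~~ e v w].
Proof.
move=> cv; have [h vh] := connected_neighbour v con_e V2.
have [svh ch] := clN_sub_of_small cv vh.
have /subsetPn[w hw vw] := clN_not_sub cv vh.
have eh : clN h = w |: clN v.
  apply/eqP; rewrite eq_sym eqEcard cardsU1 vw cv ch leqnn andbT.
  by rewrite subUset sub1set hw.
have nvw : v != w by apply: contraNneq vw => <-; apply: clN_refl.
have hnw : h != w by apply: contraNneq vw => <-; apply: edge_in_clN.
have ehw : e h w by rewrite edge_clN hnw.
have evw : ~~ e v w by apply: contra vw; apply: edge_in_clN.
(* If $|N[w]| = m$, some neighbour [x] of [w] has $N[x] \subseteq N[w]$; then [v] at [h] and [x] at
   [w] are a pair excluded by [no_pendant_pair]. *)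
have cw : #|clN w| = k.+1.
  have := card_clN_le w; rewrite leq_eqVlt => /orP[/eqP cw|].
    have [x wx sxw] := clN_sub_exists cw; exfalso.
    apply: (@no_pendant_pair h w v x) => //.
    - by rewrite clN_sym edge_in_clN.
    - by rewrite clN_sym.
    - exact: edge_in_clN.
    rewrite eh !inU negb_or eq_sym edge_neq //.
    have : v \notin clN x.
      by apply/negP => /(subsetP sxw); rewrite clN_sym (negPf vw).
    by rewrite clN_sym.
  by have := card_clN_ge w; lia.
have whE : e w h by rewrite sym_e.
have [swh _] := clN_sub_of_small cw whE.
have Nh u : e h u -> (u == v) || (u == w).
  move=> hu; apply: contraT; rewrite negb_or => /andP[uv uw]; exfalso.
  apply: (@no_third_neighbour h v w u) => //; first by rewrite sym_e.
  by rewrite eh setUC.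
have eh3 : clN h = [set v; h; w].
  apply/setP => u; rewrite !inE; apply/idP/idP => [/orP[->|/Nh/orP[]->]|];
  rewrite ?orbT // -orbA => /or3P[]/eqP->; rewrite ?eqxx ?ehw ?orbT //.
  by rewrite sym_e vh orbT.
split.
  have : #|clN h| = 3.
    by rewrite eh3 setUC cardsU1 !inE negb_or cards2
      ?(edge_neq vh) [w == v]eq_sym nvw [w == h]eq_sym hnw.
  by rewrite ch => -[].
(* Both $N[v]$ and $N[w]$ lie in $N[h]$, so $N[h]$ is closed under adjacency and is all of [V]. *)
exists h, w; split=> //; rewrite -eh3; symmetry; apply: (@connected_closed_setT _ _ _ h con_e).
  exact: clN_refl.
move=> y z; rewrite {1}eh3 !inU -orbA => /or3P[]/eqP-> yz.
- by apply: (subsetP svh); rewrite edge_in_clN.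
- exact: edge_in_clN.
- by apply: (subsetP swh); rewrite edge_in_clN.
Qed.

(** Each $N[v]$ is closed under adjacency: a neighbour [y] with $N[y]$ outside $N[v]$ would share
    only [v] and [y] with it, yet the twin [h] of [v] is a third common element. *)
Lemma regular_complete : (forall v, #|clN v| = m) ->
  #|V| = m /\ forall x y, e x y = (x != y).
Proof.
move=> reg.
have clT v : clN v = setT.
  have [h vh shv] := clN_sub_exists (reg v).
  have ehv : clN h = clN v by apply/eqP; rewrite eqEcard shv !reg leqnn.
  apply: (@connected_closed_setT _ _ _ v con_e); first exact: clN_refl.
  move=> y z vy yz; have [yv|nvy] := eqVneq v y.
    by rewrite yv edge_in_clN.
  have evy : e v y by rewrite edge_clN nvy.
  have [yh|nyh] := eqVneq h y; first by rewrite -ehv yh edge_in_clN.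
  suff /subsetP: clN y \subset clN v by apply; rewrite edge_in_clN.
  apply: contraT => nyv.
  have nvy' : ~~ (clN v \subset clN y).
    apply: contra nyv => svy; suff /eqP<- : clN v == clN y by [].
    by rewrite eqEcard svy !reg leqnn.
  have := incomparable_card_clN evy nvy' nyv.
  have := cardsUI (clN v) (clN y); rewrite !reg.
  have : h |: [set v; y] \subset clN v :&: clN y.
    rewrite subUset sub1set in_setI -ehv clN_refl.
    rewrite clN_sym ehv vy /=; exact: (card_clN_meet evy).2.
  move/subset_leq_card; rewrite cardsU1 cards2 nvy.
  rewrite !inE negb_or nyh eq_sym edge_neq //=; lia.
split; last by move=> x y; rewrite edge_clN clT inE andbT.
have [v _] : exists v : V, true by apply/card_gt0P/(leq_trans _ V2).
by rewrite -(reg v) clT cardsT.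
Qed.

End Necessity.

(** * Sufficiency: transversals inside a dominating set *)

Lemma layer_transversal (D : {set 'I_m * V}) :
    #|V| = m -> (forall v, exists i, (i, v) \in D) ->
  exists D' : {set 'I_m * V},
    [/\ D' \subset D, dominating prod D' & #|D'| = m].
Proof.
move=> cV /fin_all_exists[f fP].
exists [set (f v, v) | v : V]; split.
- by apply/subsetP => _ /imsetP[v _ ->].
- apply/dominating_prodP => -[i v]; exists (f v, v); last by rewrite /prod_adj eqxx.
  exact: imset_f.
- by rewrite card_imset // => x y [].
Qed.

Lemma card_row_graph (g : 'I_m -> V) : #|[set (i, g i) | i : 'I_m]| = m.
Proof. by rewrite card_imset ?card_ord // => x y []. Qed.

Lemma complete_well_dominated :
  #|V| = m -> (forall x y, e x y = (x != y)) -> well_dominated prod.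
Proof.
move=> cV eE; apply: (@well_dominated_const _ _ m) => D dD.
have [/forallP colD|] := boolP [forall v, [exists i, (i, v) \in D]].
  by apply: layer_transversal => // v; apply/existsP.
rewrite negb_forall => /existsP[v /existsPn nv].
(* [D] misses the $K_m$-layer over [v], so each [(i, v)] is dominated along its row. *)
have rowD (i : 'I_m) : exists x, (i, x) \in D.
  have [[j x] jxD] := (dominating_prodP D).1 dD (i, v).
  rewrite /prod_adj /= => /orP[/eqP xv|/andP[/eqP<- _]]; last by exists x.
  by have := nv j; rewrite -xv jxD.
have /fin_all_exists[f fP] := rowD.
exists [set (i, f i) | i : 'I_m]; split; rewrite ?card_row_graph //.
  by apply/subsetP => _ /imsetP[i _ ->].
apply/dominating_prodP => -[i x]; exists (i, f i); first exact: imset_f.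
by rewrite /prod_adj eqxx eE /=; case: eqP.
Qed.

Lemma path_well_dominated v h w : k = 1 -> [set: V] = [set v; h; w] ->
    v != w -> e v h -> e h w -> ~~ e v w -> well_dominated prod.
Proof.
move=> k1 VE nvw vh hw evw; apply: (@well_dominated_const _ _ m) => D dD.
have inV x : [\/ x = v, x = h | x = w].
  by have := in_setT x; rewrite VE !inE -orbA => /or3P[]/eqP->;
    [apply: Or31|apply: Or32|apply: Or33].
have neq x y : e x y -> x != y by rewrite edge_clN => /andP[].
have cV : #|V| = m.
  rewrite -cardsT VE k1 setUC cardsU1 !inE negb_or cards2.
  by rewrite (neq _ _ vh) [w == v]eq_sym nvw [w == h]eq_sym (neq _ _ hw).
have {}dD := (dominating_prodP D).1 dD.
have [/forallP colD|] := boolP [forall u, [exists i, (i, u) \in D]].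
  by apply: layer_transversal => // u; apply/existsP.
rewrite negb_forall => /existsP[u /existsPn nu].
have rowD (i : 'I_m) : exists2 x, (i, x) \in D & e x u.
  have [[j x] jxD] := dD (i, u).
  rewrite /prod_adj /= => /orP[/eqP xu|/andP[/eqP<-]]; last by exists x.
  by have := nu j; rewrite -xu jxD.
(* If the missed layer lies over an end of the path, [h] is its only neighbour, so [D] contains the
   whole layer over [h]. *)
have [uh|uh] := eqVneq u h; last first.
  have colh (i : 'I_m) : (i, h) \in D.
    have [x xD xu] := rowD i; case: (inV x) => xE; rewrite -?xE //.
      case: (inV u) uh xu => ->; rewrite xE ?irr_e ?eqxx //.
      by rewrite (negPf evw).
    case: (inV u) uh xu => ->; rewrite xE ?irr_e ?eqxx //.
    by rewrite sym_e (negPf evw).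
  exists [set (i, h) | i : 'I_m]; split; rewrite ?card_row_graph //.
    by apply/subsetP => _ /imsetP[i _ ->].
  apply/dominating_prodP => -[i x]; exists (i, h); first exact: imset_f.
  rewrite /prod_adj eqxx /=.
  by case: (inV x) => ->; rewrite ?eqxx // ?hw 1?sym_e ?vh ?orbT.
have rowvw (i : 'I_m) : (i, v) \in D \/ (i, w) \in D.
  have [x xD]:= rowD i; rewrite uh; case: (inV x) => xE; rewrite -?xE ?irr_e //.
    by left.
  by right.
have noh i : (i, h) \notin D by rewrite -uh nu.
have colv : exists a, (a, v) \in D.
  have [[a x] axD] := dD (ord0, v); rewrite /prod_adj /=.
  case/orP => [/eqP<-|/andP[_]]; first by exists a.
  case: (inV x) axD => ->; rewrite ?irr_e // ?(negPf (noh _)) //.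
  by rewrite sym_e (negPf evw).
have colw : exists b, (b, w) \in D.
  have [[b x] bxD] := dD (ord0, w); rewrite /prod_adj /=.
  case/orP => [/eqP<-|/andP[_]]; first by exists b.
  by case: (inV x) bxD => ->; rewrite ?irr_e // ?(negPf (noh _)) // (negPf evw).
(* Distinct rows [a] and [b] let one transversal of the rows meet the layers over both ends; when
   the two found rows coincide, a further row [c] replaces one of them. *)
have [a [b [aD bD ab]]] : exists a b, [/\ (a, v) \in D, (b, w) \in D & a != b].
  have [[a aD] [b bD]] := (colv, colw).
  have [ab|ab] := eqVneq a b; last by exists a, b.
  have [c ca] : exists c : 'I_m, c != a.
    by have [->|] := eqVneq a ord0; [exists ord_max|exists ord0; rewrite eq_sym].
  case: (rowvw c) => cD; first by exists c, b; rewrite -{2}ab.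
  by exists a, c; rewrite eq_sym.
pose g i := if i == a then v else if i == b then w else
            if (i, v) \in D then v else w.
have gD i : (i, g i) \in D.
  rewrite /g; have [->//|_] := eqVneq i a; have [->//|_] := eqVneq i b.
  by case: ifP => // iv; case: (rowvw i) => //; rewrite iv.
exists [set (i, g i) | i : 'I_m]; split; rewrite ?card_row_graph //.
  by apply/subsetP => _ /imsetP[i _ ->].
apply/dominating_prodP => -[i x]; case: (inV x) => ->.
- exists (a, g a); first exact: imset_f.
  by rewrite /g /prod_adj !eqxx.
- exists (i, g i); first exact: imset_f.
  rewrite /prod_adj eqxx /= /g; case: ifP => _; first by rewrite vh orbT.
  by case: ifP => _; [|case: ifP => _]; rewrite ?vh 1?sym_e ?hw 1?sym_e ?vh ?orbT.
- exists (b, g b); first exact: imset_f.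
  by rewrite /g /prod_adj [b == a]eq_sym (negPf ab) !eqxx.
Qed.

End Product.

(** * Intrinsic descriptions of the two isomorphism types, and the equivalence *)

Lemma graph_iso_complete (V : finType) (e : rel V) m :
  graph_iso e (complete_graph m) <-> #|V| = m /\ forall x y, e x y = (x != y).
Proof.
split=> [[f [bij_f ef]]|[cV eE]].
  split; first by rewrite (bij_eq_card bij_f) card_ord.
  by move=> x y; rewrite -ef /complete_graph (bij_eq bij_f).
move: cV => <-; exists enum_rank; split; first exact: enum_rank_bij.
by move=> x y; rewrite eE /complete_graph (inj_eq enum_rank_inj).
Qed.

Lemma graph_iso_path3 (V : finType) (e : rel V) :
  simple_graph e -> graph_iso e path3 <->
  exists v h w, [/\ [set: V] = [set v; h; w], v != w, e v h, e h w & ~~ e v w].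
Proof.
case=> sym_e irr_e; split=> [[f [[g fK gK] ef]]|[v [h [w [VE vw evh ehw nvw]]]]].
  pose o i (lt : i < 3) := g (Ordinal lt).
  exists (@o 0 isT), (@o 1 isT), (@o 2 isT).
  rewrite -!ef !gK (can_eq gK) /path3 /=; split=> //.
  apply/setP => x; rewrite !inE -!(can_eq fK) !gK.
  by case: (f x) => -[|[|[|]]].
have neq x y : e x y -> x != y by apply: contraTneq => ->; rewrite irr_e.
have [vh hw] := (neq _ _ evh, neq _ _ ehw).
pose f x : 'I_3 := if x == v then @Ordinal 3 0 isT
                   else if x == h then @Ordinal 3 1 isT else @Ordinal 3 2 isT.
have inV x : [\/ x = v, x = h | x = w].
  by have := in_setT x; rewrite VE !inE -orbA => /or3P[]/eqP->;
    [apply: Or31|apply: Or32|apply: Or33].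
have fv : f v = @Ordinal 3 0 isT by rewrite /f eqxx.
have fh : f h = @Ordinal 3 1 isT by rewrite /f eq_sym (negPf vh) eqxx.
have fw : f w = @Ordinal 3 2 isT.
  by rewrite /f [w == v]eq_sym (negPf vw) [w == h]eq_sym (negPf hw).
exists f; split.
  apply: inj_card_bij => [x y|].
    by case: (inV x) => ->; case: (inV y) => ->; rewrite ?fv ?fh ?fw.
  by rewrite card_ord -cardsT VE setUC cardsU1 cards2 !inE negb_or vh
    [w == v]eq_sym vw [w == h]eq_sym hw.
move=> x y; case: (inV x) => ->; case: (inV y) => ->;
rewrite ?fv ?fh ?fw /path3 /= ?irr_e ?evh ?ehw ?(negPf nvw) //.
- by rewrite sym_e evh.
- by rewrite sym_e (negPf nvw).
- by rewrite sym_e ehw.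
Qed.

Theorem theorem3 (m : nat) (V : finType) (e : rel V) :
  2 <= m -> simple_graph e -> connected_graph e -> 2 <= #|V| ->
  (well_dominated (cartesian_product (complete_graph m) e) <->
   ((m != 3) /\ graph_iso e (complete_graph m)) \/
   ((m = 3) /\ (graph_iso e (complete_graph 3) \/ graph_iso e path3))).
Proof.
case: m => [|[|k]] // _ se con V2; have [sym_e irr_e] := se.
split=> [wd|].
  have [/existsP[v /eqP cv]|] := boolP [exists v, #|clN e v| == k.+1].
    have [k1 [h [w [VE vw vh hw nvw]]]] :=
      small_degree_path sym_e irr_e con V2 wd cv.
    right; split; first by rewrite k1.
    by right; apply/graph_iso_path3 => //; exists v, h, w.
  move=> /existsPn nsmall.
  have /(graph_iso_complete e k.+2) iso : #|V| = k.+2 /\ forall x y, e x y = (x != y).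
    (* Once the value $m-1$ is excluded, the two bounds on $|N[v]|$ leave only $m$. *)
    apply: (regular_complete sym_e irr_e con V2 wd) => v.
    have := card_clN_ge irr_e con V2 wd v.
    have := card_clN_le wd v; have := nsmall v.
    by move/eqP; lia.
  have [E|] := eqVneq k.+2 3; last by left.
  by right; split=> //; left; rewrite -E.
case=> [[_ /graph_iso_complete[cV eE]]|[k1 [|]]].
- exact: complete_well_dominated.
- by rewrite -k1 => /graph_iso_complete[cV eE]; apply: complete_well_dominated.
case/(graph_iso_path3 se) => v [h [w [VE vw vh hw nvw]]].
by case: k1 => k1; apply: path_well_dominated VE vw vh hw nvw.
Qed.
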